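(* Let $r\in\mathbb{N}$, let $g$ be a polynomial with integer coefficients and $G=(g,\ldots,g)$ ($r$ copies). If $m_1,\ldots,m_r\in\mathbb{N}$ are pairwise relatively prime and $m=\operatorname{lcm}(m_1,\ldots,m_r)$, then $R_G(m_1,\ldots,m_r)=R_g(m)$.
   Context: For $n\in\mathbb{N}$ and $k\in\mathbb{Z}$, $c_n(k)=\sum_{1\le j\le n,\ \gcd(j,n)=1}\exp(2\pi i jk/n)$ is the Ramanujan sum. $R_G(m_1,\ldots,m_r)=\sum_{1\le k\le m,\ \gcd(k,m)=1}c_{m_1}(g(k))\cdots c_{m_r}(g(k))$ with $m=\operatorname{lcm}(m_1,\ldots,m_r)$, and $R_g(n)=\sum_{1\le k\le n,\ \gcd(k,n)=1}c_n(g(k))$. *)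

(* Defs.v *)
From mathcomp Require Import all_boot all_order all_algebra.
From mathcomp Require Import complex.
From mathcomp Require Import reals sequences trigo.

Set Implicit Arguments.
Unset Strict Implicit.
Unset Printing Implicit Defensive.

Import GRing.Theory Num.Theory.
Local Open Scope ring_scope.
Local Open Scope complex_scope.

(* exp (x + iy) = e^x (cos y + i sin y). *)
Definition cexp (R : realType) (z : R[i]) : R[i] :=
  (expR (complex.Re z))%:C * (cos (complex.Im z) +i* sin (complex.Im z)).

Definition ramanujan_sum (R : realType) (n : nat) (k : int) : R[i] :=
  \sum_(1 <= j < n.+1 | coprime j n)
    cexp (2 * (pi : R)%:C * 'i * j%:R * k%:~R / n%:R).

Definition lcm_fam (r : nat) (m : 'I_r -> nat) : nat :=
  \big[lcmn/1%N]_(i < r) m i.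

Definition R_fam (R : realType) (r : nat) (G : 'I_r -> {poly int})
    (m : 'I_r -> nat) : R[i] :=
  \sum_(1 <= k < (lcm_fam m).+1 | coprime k (lcm_fam m))
    \prod_(i < r) ramanujan_sum R (m i) (G i).[k%:Z].

Definition R_single (R : realType) (g : {poly int}) (n : nat) : R[i] :=
  \sum_(1 <= k < n.+1 | coprime k n) ramanujan_sum R n g.[k%:Z].

(* Main.v *)
Require Import Defs.
From mathcomp Require Import all_boot all_order all_algebra.
From mathcomp Require Import complex.
From mathcomp Require Import reals sequences trigo.
From mathcomp Require Import exp ring.

(** For coprime [a], [b], the Chinese remainder theorem says that
    [(u, v) |-> u b + v a] maps the pairs of units mod [a] and mod [b]
    bijectively onto the units mod [a b]; since [e(u/a) e(v/b) =
    e((u b + v a) / (a b))], the Ramanujan sum [c_n(k)] is multiplicative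
    in [n].  Hence the product in the definition of [R_G] collapses to
    [c_m(g(k))], term by term. *)

Set Implicit Arguments.
Unset Strict Implicit.
Unset Printing Implicit Defensive.

Import GRing.Theory Num.Theory.
Local Open Scope ring_scope.
Local Open Scope complex_scope.

(** Both [0] and [n] are coprime to [n] exactly when [n = 1], so the last term can be traded for a
    term at [0]. Ordinals then serve as residues for the Chinese remainder map. *)
Lemma sum_coprime_ord (V : nmodType) (n : nat) (F : nat -> V) :
  (0 < n)%N -> F n = F 0%N ->
  \sum_(1 <= j < n.+1 | coprime j n) F j = \sum_(j < n | coprime j n) F j.
Proof.
case: n => [//|n] _ Fn.
rewrite big_mkcond big_add1 big_nat_recr //=.
rewrite -(big_mkord (fun j => coprime j n.+1)) [RHS]big_mkcond big_nat_recl //=.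
by rewrite addrC Fn /coprime gcdnn gcd0n.
Qed.

Lemma coprime_muladd (a b u v : nat) : coprime a b ->
  coprime (u * b + v * a) a = coprime u a.
Proof.
move=> ab; rewrite -coprime_modl addnC modnMDl coprime_modl coprimeMl.
by rewrite [coprime b a]coprime_sym ab andbT.
Qed.

Lemma eqmod_mul2r_coprime (a b u v : nat) : coprime a b ->
  (u * b == v * b %[mod a]) = (u == v %[mod a]).
Proof.
move=> ab; wlog vu : u v / (v <= u)%N => [IH|].
  by case/orP: (leq_total v u) => /IH // E; rewrite eq_sym E eq_sym.
by rewrite !eqn_mod_dvd ?leq_mul2r ?vu ?orbT // -mulnBl Gauss_dvdl.
Qed.

Lemma eqmod_muladd (a b u u' v v' : nat) : coprime a b ->
  u * b + v * a = u' * b + v' * a %[mod a] -> u = u' %[mod a].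
Proof.
move=> ab; rewrite addnC modnMDl addnC modnMDl => /eqP.
by rewrite eqmod_mul2r_coprime // => /eqP.
Qed.

Lemma coprime_biglcmn (I : eqType) (s : seq I) (m : I -> nat) (n : nat) :
  (forall i, i \in s -> coprime n (m i)) ->
  coprime n (\big[lcmn/1%N]_(i <- s) m i).
Proof.
move=> cop; rewrite big_seq; elim/big_ind: _ => [|x y nx ny|//].
  exact: coprimen1.
apply: (@coprime_dvdr _ (x * y)); last by rewrite coprimeMr nx.
by rewrite dvdn_lcm dvdn_mulr ?dvdn_mull.
Qed.

Lemma lcmn_coprime (a b : nat) : coprime a b -> lcmn a b = (a * b)%N.
Proof. by move=> /eqP ab; rewrite -muln_lcm_gcd ab muln1. Qed.

Section ChineseRemainder.
Variables (a b : nat).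
Hypotheses (a_gt0 : (0 < a)%N) (b_gt0 : (0 < b)%N) (ab : coprime a b).

Let ab_gt0 : (0 < a * b)%N. Proof. by rewrite muln_gt0 a_gt0. Qed.

Definition crt_ord (p : 'I_a * 'I_b) : 'I_(a * b) :=
  Ordinal (ltn_pmod (p.1 * b + p.2 * a) ab_gt0).

Lemma crt_ord_bij : bijective crt_ord.
Proof.
apply: inj_card_bij; last by rewrite card_prod !card_ord.
move=> [u v] [u' v'] /(congr1 val)/= /eqP; rewrite chinese_remainder //.
case/andP=> /eqP /(eqmod_muladd ab) Eu /eqP.
(* Swapping the summands exchanges the roles of [a] and [b], so the same cancellation applies modulo
   [b]. *)
rewrite addnC [X in _ = X %[mod _]]addnC => /(eqmod_muladd _) Ev.
congr (_, _); apply: val_inj; first by move: Eu; rewrite !modn_small.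
by move: Ev; rewrite !modn_small //; apply; rewrite coprime_sym.
Qed.

Lemma coprime_crt_ord (p : 'I_a * 'I_b) :
  coprime (crt_ord p) (a * b) = coprime p.1 a && coprime p.2 b.
Proof.
rewrite coprime_modl coprimeMr coprime_muladd // addnC coprime_muladd //.
by rewrite coprime_sym.
Qed.

(** The algebraic core of multiplicativity, to be used with [z] $= e(k/(ab))$, so that [z ^+ b] $=
    e(k/a)$ and [z ^+ a] $= e(k/b)$. *)
Lemma sum_coprime_expM (S : comPzRingType) (z : S) : z ^+ (a * b) = 1 ->
  \sum_(1 <= j < (a * b).+1 | coprime j (a * b)) z ^+ j =
  (\sum_(1 <= j < a.+1 | coprime j a) (z ^+ b) ^+ j) *
  (\sum_(1 <= j < b.+1 | coprime j b) (z ^+ a) ^+ j).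
Proof.
move=> z1; rewrite (sum_coprime_ord ab_gt0) ?z1 //.
rewrite (sum_coprime_ord a_gt0); last by rewrite -exprM mulnC z1.
rewrite (sum_coprime_ord b_gt0); last by rewrite -exprM z1.
rewrite (reindex crt_ord) /=; last exact/onW_bij/crt_ord_bij.
rewrite big_distrlr pair_big /=; apply: eq_big => [p | [u v] _] /=.
  exact: coprime_crt_ord.
(* Since [z ^+ (a * b) = 1], the reduction modulo [a * b] in [crt_ord] does not change the power. *)
by rewrite expr_mod // exprD -!exprM (mulnC b) (mulnC a).
Qed.

End ChineseRemainder.

Section ComplexExponential.
Variable R : realType.
Implicit Types (z w : R[i]) (n : nat) (k : int).

Lemma cexpD z w : cexp (z + w) = cexp z * cexp w.
Proof.
case: z w => [x y] [x' y']; rewrite /cexp /= expRD cosD sinD.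
by apply/eqP; rewrite eq_complex /=; apply/andP; split; apply/eqP; ring.
Qed.

Lemma cexp0 : cexp (0 : R[i]) = 1.
Proof. by rewrite /cexp /= expR0 cos0 sin0 mul1r. Qed.

Lemma cexpMn z n : cexp (z *+ n) = cexp z ^+ n.
Proof.
by elim: n => [|n IHn]; rewrite ?mulr0n ?cexp0 // mulrS exprS cexpD IHn.
Qed.

Lemma cexpMz_eq1 z k : cexp z = 1 -> cexp (z *~ k) = 1.
Proof.
move=> z1; case: k => n; first by rewrite -pmulrn cexpMn z1 expr1n.
(* For a negative multiple, [cexp (- w)] is the inverse of [cexp w], which is [1] by the natural
   case. *)
have: cexp (- (z *+ n.+1)) * cexp (z *+ n.+1) = 1 by rewrite -cexpD addNr cexp0.
by rewrite cexpMn z1 expr1n mulr1 NegzE mulrNz.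
Qed.

Lemma cexp_2pi_i : cexp (2 * (pi : R)%:C * 'i) = 1.
Proof.
rewrite /cexp -complexiE mulr_natl mulr2n /=.
rewrite !(mul0r, mulr0, mulr1, addr0, add0r, subr0, oppr0).
by rewrite -mulr2n cos2pi sin2pi expR0 mul1r.
Qed.

(** Isolating [j] as an exponent turns the sum into powers of one root of unity, the shape
    [sum_coprime_expM] expects. *)
Lemma ramanujan_sum_exp n k :
  ramanujan_sum R n k = \sum_(1 <= j < n.+1 | coprime j n)
    cexp (2 * (pi : R)%:C * 'i * k%:~R / n%:R) ^+ j.
Proof.
apply: eq_bigr => j _; rewrite -cexpMn; congr cexp.
by rewrite -[RHS]mulr_natr [RHS]mulrAC [X in _ = X / _]mulrAC.
Qed.

Lemma ramanujan_sum1 k : ramanujan_sum R 1 k = 1.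
Proof.
rewrite ramanujan_sum_exp big_mkcond big_nat1 /= divr1 mulrzr.
by rewrite cexpMz_eq1 // cexp_2pi_i.
Qed.

Lemma ramanujan_sumM (a b : nat) k : (0 < a)%N -> (0 < b)%N -> coprime a b ->
  ramanujan_sum R (a * b) k = ramanujan_sum R a k * ramanujan_sum R b k.
Proof.
move=> a0 b0 ab; rewrite !ramanujan_sum_exp.
have aN0 : a%:R != 0 :> R[i] by rewrite pnatr_eq0 -lt0n.
have bN0 : b%:R != 0 :> R[i] by rewrite pnatr_eq0 -lt0n.
have cexpX z n : cexp z ^+ n = cexp (z * n%:R) by rewrite mulr_natr cexpMn.
rewrite sum_coprime_expM // !cexpX natrM.
  congr (_ * _); apply: eq_bigr => j _; congr (cexp _ ^+ _).
    by rewrite invfM mulrA divfK.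
  by rewrite [a%:R * _]mulrC invfM mulrA divfK.
(* What remains is [z ^+ (a * b) = 1]: the denominator cancels and leaves $e^{2\pi i k} = 1$. *)
rewrite divfK ?mulf_neq0 // mulrzr.
by rewrite cexpMz_eq1 // cexp_2pi_i.
Qed.

(** Stated over a duplicate-free sequence to allow induction: the head index differs from every
    later one, so its modulus is coprime to the lcm of the tail, and that lcm with the head is a
    product. *)
Lemma ramanujan_sum_prod (I : eqType) (s : seq I) (m : I -> nat) k :
  uniq s -> (forall i, 0 < m i)%N ->
  (forall i j, i != j -> coprime (m i) (m j)) ->
  \prod_(i <- s) ramanujan_sum R (m i) k =
  ramanujan_sum R (\big[lcmn/1%N]_(i <- s) m i) k.
Proof.
move=> us m_gt0 cop; elim: s us => [|i s IHs] /=.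
  by rewrite !big_nil ramanujan_sum1.
rewrite !big_cons => /andP[nis us]; rewrite (IHs us).
have copi : coprime (m i) (\big[lcmn/1%N]_(j <- s) m j).
  by apply: coprime_biglcmn => j js; apply: cop; apply: contraNneq nis => ->.
rewrite lcmn_coprime // ramanujan_sumM //.
by elim/big_ind: _ => // x y x_gt0 y_gt0; rewrite lcmn_gt0 x_gt0.
Qed.

End ComplexExponential.

Theorem corollary7 (R : realType) (r : nat) (hr : (0 < r)%N)
    (g : {poly int}) (m : 'I_r -> nat)
    (m_pos : forall i : 'I_r, (0 < m i)%N)
    (m_coprime : forall i j : 'I_r, i != j -> coprime (m i) (m j)) :
  R_fam R (fun _ : 'I_r => g) m = R_single R g (lcm_fam m).
Proof.
apply: eq_bigr => k _; apply: ramanujan_sum_prod => //.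
exact: index_enum_uniq.
Qed.
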